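(* Let $A=(A,\cdot,\circ)$ and $B=(B,\cdot,\circ)$ be skew braces and let $$\varphi : (B,\circ) \rightarrow \mathrm{Aut}(A,\circ), \qquad \theta : (B,\cdot) \rightarrow \mathrm{Aut}(A,\cdot)$$ be group homomorphisms, written $b \mapsto \varphi_b$ and $b \mapsto \theta_b$. Let $A \rtimes_{\theta}^{\varphi} B$ denote the Cartesian product $A \times B$ together with the operations $$(a,b) \circ (a',b') = (a \circ \varphi_{b}(a'),\, b \circ b'), \qquad (a,b) \cdot (a',b') = (a \cdot \theta_{b}(a'),\, b \cdot b').$$ The following statements are equivalent: (1) $A \rtimes_{\theta}^{\varphi} B$ is a skew brace; (2) the skew brace $B$ acts on the skew brace $A$ via $\varphi$ (that is, $\varphi_b$ is a skew brace automorphism of $A$ for every $b \in B$) and the following equations hold inside $\mathrm{Aut}(A,\cdot)$: $$\gamma_{a} \theta_{b} = \theta_{b} \gamma_{a} \quad \text{for all } a \in A \text{ and } b \in B,$$ $$\varphi_{b} \theta_{b'} = \theta_{b \gamma_{b}(b') b^{-1}} \varphi_{b} \quad \text{for all } b, b' \in B.$$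
   Context: A (left) skew brace is a triple $(G,\cdot,\circ)$ in which $(G,\cdot)$ and $(G,\circ)$ are groups and $x \circ (y \cdot z) = (x \circ y) \cdot x^{-1} \cdot (x \circ z)$ for all $x,y,z \in G$, where $x^{-1}$ denotes the inverse of $x$ with respect to $\cdot$. The symbol $\cdot$ is often suppressed, so $b\gamma_b(b')b^{-1}$ is a product with respect to $\cdot$. The $\gamma$-function of a skew brace $G$ is the homomorphism $\gamma : (G,\circ) \to \mathrm{Aut}(G,\cdot)$ given by $\gamma_x(y) = x^{-1}\cdot(x \circ y)$. In the displayed equations $\gamma_a$ (for $a\in A$) refers to the $\gamma$-function of $A$ and $\gamma_b$ (for $b \in B$) to the $\gamma$-function of $B$. A skew brace automorphism of $A$ is a bijection $A \to A$ respecting both $\cdot$ and $\circ$; these form the group $\mathrm{Aut}(A)$. A skew brace $B$ acts on a skew brace $A$ via $\varphi$ if $\varphi$ is a homomorphism $(B,\circ)\to \mathrm{Aut}(A)$. *)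

(* Defs.v *)
From mathcomp Require Import all_boot.

Set Implicit Arguments.
Unset Strict Implicit.
Unset Printing Implicit Defensive.

(* Group structures on a bare type.  MathComp's groupType attaches one canonical
   multiplication to a carrier and requires a choiceType, whereas a skew brace
   has two groups on the same, arbitrary, carrier. *)
Record group_law (T : Type) := GroupLaw {
  gmul :> T -> T -> T;
  gone : T;
  ginv : T -> T;
  gmulA : associative gmul;
  gmul1x : left_id gone gmul;
  gmulx1 : right_id gone gmul;
  gmulVx : left_inverse gone ginv gmul;
  gmulxV : right_inverse gone ginv gmul
}.

Definition skew_brace_axiom (T : Type) (D C : group_law T) : Prop :=
  forall x y z : T, C x (D y z) = D (D (C x y) (ginv D x)) (C x z).

Record skewBrace := SkewBrace {
  carrier :> Type;
  dot_law : group_law carrier;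
  circ_law : group_law carrier;
  skew_braceP : skew_brace_axiom dot_law circ_law
}.

Arguments dot_law G : rename.
Arguments circ_law G : rename.

Declare Scope brace_scope.
Delimit Scope brace_scope with B.
Notation "x · y" := (dot_law _ x y) (at level 40, left associativity) : brace_scope.
Notation "x ∘ y" := (circ_law _ x y) (at level 40, left associativity) : brace_scope.
Notation "x ^-1" := (ginv (dot_law _) x) : brace_scope.
Local Open Scope brace_scope.

Definition is_skew_brace (T : Type) (dot circ : T -> T -> T) : Prop :=
  exists D C : group_law T,
    [/\ gmul D =2 dot, gmul C =2 circ & skew_brace_axiom D C].

Definition gamma (G : skewBrace) (x y : G) : G := x^-1 · (x ∘ y).

Definition is_group_aut (T : Type) (L : group_law T) (f : T -> T) : Prop :=
  bijective f /\ {morph f : x y / L x y}.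

Definition is_brace_aut (G : skewBrace) (f : G -> G) : Prop :=
  [/\ bijective f, {morph f : x y / x · y} & {morph f : x y / x ∘ y}].

(* [f] is a homomorphism from [L] to the group of the self-maps satisfying [Aut],
   whose product is composition of maps: f (x y) = f x \o f y. *)
Definition is_hom_to_auts (S T : Type) (L : group_law S) (Aut : (T -> T) -> Prop)
    (f : S -> T -> T) : Prop :=
  (forall x, Aut (f x)) /\ (forall x y, f (L x y) =1 f x \o f y).

Definition brace_acts (B A : skewBrace) (phi : B -> A -> A) : Prop :=
  is_hom_to_auts (circ_law B) (@is_brace_aut A) phi.

Definition sdprod_mul (S T : Type) (mulS : S -> S -> S) (mulT : T -> T -> T)
    (f : T -> S -> S) (p q : S * T) : S * T :=
  (mulS p.1 (f p.2 q.1), mulT p.2 q.2).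

(* Main.v *)
Require Import Defs.
From mathcomp Require Import all_boot.

(** For x = (a, b), y = (a', b') and z = (a'', b''), the skew brace identity
    holds automatically in the second coordinate; after cancelling a on the
    left, and writing c = b γ_b(b') b^-1 = (b ∘ b') b^-1, in the first
    coordinate it says
      γ_a φ_b (a' · θ_b'(a'')) = γ_a φ_b (a') · θ_c γ_a φ_b (a'').
    As γ_1 and φ_1 are identities, b' = 1 and a = 1 make φ_b multiplicative;
    a' = 1 with a = 1, resp. with b = 1, gives the two equations in
    Aut(A, ·).  Conversely, these three facts together yield the identity. *)

Local Open Scope brace_scope.

Section GroupLaws.
Context {T : Type} (L : group_law T).

Lemma gmulKV x y : L (ginv L x) (L x y) = y.
Proof. by rewrite gmulA gmulVx gmul1x. Qed.

Lemma gmulI x : injective (L x).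
Proof. by move=> y z exyz; rewrite -(gmulKV x y) exyz gmulKV. Qed.

Lemma ginv1 : ginv L (gone L) = gone L.
Proof. by rewrite -[LHS](gmul1x L) gmulxV. Qed.

Lemma gmul_idem x : L x x = x -> x = gone L.
Proof. by move=> exx; apply: (gmulI x); rewrite exx gmulx1. Qed.

Lemma gone_unique (L' : group_law T) : gmul L =2 gmul L' -> gone L = gone L'.
Proof. by move=> eL; rewrite -[LHS](gmul1x L') -eL gmulx1. Qed.

Lemma ginv_unique (L' : group_law T) : gmul L =2 gmul L' -> ginv L =1 ginv L'.
Proof.
move=> eL x; apply: (gmulI x).
by rewrite gmulxV eL gmulxV; apply: gone_unique.
Qed.

Lemma group_aut1 f : is_group_aut L f -> f (gone L) = gone L.
Proof. by case=> _ fM; apply: gmul_idem; rewrite -fM gmulx1. Qed.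

End GroupLaws.

(** [f 1] composed with itself is [f 1], and an injective idempotent map is the identity. *)
Lemma hom_to_auts1 {S T : Type} {L : group_law S} {M : group_law T}
    {f : S -> T -> T} :
  is_hom_to_auts L (is_group_aut M) f -> f (gone L) =1 id.
Proof.
case=> fA fM x; have [[g fK _] _] := fA (gone L).
by have := fM (gone L) (gone L) x; rewrite gmulx1 => /(can_inj fK).
Qed.

Section SemidirectProduct.
Context {S T : Type} {L : group_law S} {M : group_law T} {f : T -> S -> S}.
Hypothesis f_hom : is_hom_to_auts M (is_group_aut L) f.

Local Notation mul := (sdprod_mul L M f).
Local Notation one := (gone L, gone M).
Local Notation inv := (fun p => (f (ginv M p.2) (ginv L p.1), ginv M p.2)).

Let fD b : {morph f b : x y / L x y}. Proof. by case: (f_hom.1 b). Qed.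
Let f1 b : f b (gone L) = gone L. Proof. exact: group_aut1 (f_hom.1 b). Qed.
Let fM b c x : f (M b c) x = f b (f c x). Proof. exact: f_hom.2. Qed.

Lemma sdprod_mulA : associative mul.
Proof. by move=> [a b] [c d] [x y]; rewrite /sdprod_mul /= fD fM !gmulA. Qed.

Lemma sdprod_mul1x : left_id one mul.
Proof. by move=> [a b]; rewrite /sdprod_mul /= (hom_to_auts1 f_hom) !gmul1x. Qed.

Lemma sdprod_mulx1 : right_id one mul.
Proof. by move=> [a b]; rewrite /sdprod_mul /= f1 !gmulx1. Qed.

Lemma sdprod_mulVx : left_inverse one inv mul.
Proof. by move=> [a b]; rewrite /sdprod_mul /= -fD !gmulVx f1. Qed.

Lemma sdprod_mulxV : right_inverse one inv mul.
Proof.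
move=> [a b]; rewrite /sdprod_mul /= -fM !gmulxV.
by rewrite (hom_to_auts1 f_hom) gmulxV.
Qed.

(** Used for both [theta] with the dot laws and [phi] with the circle laws, so that only the
    compatibility of the two products remains to be studied. *)
Definition sdprod_law : group_law (S * T) :=
  GroupLaw sdprod_mulA sdprod_mul1x sdprod_mulx1 sdprod_mulVx sdprod_mulxV.

End SemidirectProduct.

(** A multiplication determines its identity and inverses, so the group laws chosen in the
    existential do not matter. *)
Lemma is_skew_braceE {T : Type} (D C : group_law T) :
  is_skew_brace D C <-> skew_brace_axiom D C.
Proof.
split=> [[D' [C' [eD eC brDC]]] x y z | brDC]; last by exists D, C.
by rewrite -!eD -!eC brDC (ginv_unique _ _ eD).
Qed.

Section Gamma.
Context {G : skewBrace}.
Implicit Types x y z : G.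

Lemma circ_dot x y : x ∘ y = x · gamma x y.
Proof. by rewrite /gamma gmulA gmulxV gmul1x. Qed.

Lemma gammaM x : {morph gamma x : y z / y · z}.
Proof. by move=> y z; rewrite /gamma skew_braceP !gmulA. Qed.

Lemma gamma_1 x : gamma x (gone (dot_law G)) = gone (dot_law G).
Proof. by apply: gmul_idem; rewrite -gammaM gmulx1. Qed.

(** For the circle identity e, γ_e(1) = e^-1 · (e ∘ 1) = e^-1, while γ_e fixes 1; hence e^-1 = 1. *)
Lemma gone_circ : gone (circ_law G) = gone (dot_law G).
Proof.
have := gamma_1 (gone (circ_law G)); rewrite /gamma gmul1x gmulx1 => e1V.
by rewrite -[LHS](gmulx1 (dot_law G)) -{1}e1V gmulxV.
Qed.

Lemma gamma1 : gamma (gone (dot_law G)) =1 id.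
Proof.
move=> y; apply: (gmulI (dot_law G) (gone (dot_law G))).
by rewrite -circ_dot gmul1x -gone_circ gmul1x.
Qed.

End Gamma.

Section SkewBraceSemidirectProduct.
Context {A B : skewBrace} {phi theta : B -> A -> A}.
Hypothesis phi_hom : is_hom_to_auts (circ_law B) (is_group_aut (circ_law A)) phi.
Hypothesis theta_hom : is_hom_to_auts (dot_law B) (is_group_aut (dot_law A)) theta.

Lemma sdprod_skew_braceE :
  skew_brace_axiom (sdprod_law theta_hom) (sdprod_law phi_hom) <->
  forall (a x y : A) (b b' : B),
    gamma a (phi b (x · theta b' y)) =
    gamma a (phi b x) · theta (b · gamma b b' · b^-1) (gamma a (phi b y)).
Proof.
have [thA thM] := theta_hom.
have eqE (a x y : A) (b b' b'' : B) :
    sdprod_law theta_hom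
      (sdprod_law theta_hom (sdprod_law phi_hom (a, b) (x, b'))
         (ginv (sdprod_law theta_hom) (a, b)))
      (sdprod_law phi_hom (a, b) (y, b'')) =
    (a · (gamma a (phi b x) ·
          theta (b · gamma b b' · b^-1) (gamma a (phi b y))),
     b ∘ (b' · b'')).
  rewrite skew_braceP /= /sdprod_mul /=; congr pair.
  (* The inverse of (a, b) is (θ_{b^-1}(a^-1), b^-1). Its first entry thus contributes θ_c(a^-1)
     with c = (b ∘ b') b^-1, which merges with θ_c(a ∘ φ_b(y)) into θ_c(γ_a φ_b(y)). *)
  have /= <- := thM (b ∘ b') b^-1 a^-1; rewrite -gmulA.
  by case: (thA (b ∘ b' · b^-1)) => _ <-; rewrite [RHS]gmulA -!circ_dot.
split=> [brS a x y b b' | brE [a b] [x b'] [y b'']].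
(* Only first coordinates are compared, so the last entry [b'] is an arbitrary filler. *)
- have := brS (a, b) (x, b') (y, b'); rewrite eqE => /(congr1 fst) eA.
  by apply: (gmulI (dot_law A) a); rewrite -circ_dot.
- by rewrite eqE /= /sdprod_mul /= circ_dot brE.
Qed.

End SkewBraceSemidirectProduct.

Theorem theorem3p4 (A B : skewBrace) (phi theta : B -> A -> A)
    (phi_hom : is_hom_to_auts (circ_law B) (is_group_aut (circ_law A)) phi)
    (theta_hom : is_hom_to_auts (dot_law B) (is_group_aut (dot_law A)) theta) :
  is_skew_brace (sdprod_mul (dot_law A) (dot_law B) theta)
                (sdprod_mul (circ_law A) (circ_law B) phi)
  <->
  [/\ brace_acts phi,
      forall (a : A) (b : B), gamma a \o theta b =1 theta b \o gamma a &
      forall b b' : B,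
        phi b \o theta b' =1 theta (b · gamma b b' · b^-1) \o phi b].
Proof.
have sdE := iff_trans (is_skew_braceE (sdprod_law theta_hom) (sdprod_law phi_hom))
                      (sdprod_skew_braceE phi_hom theta_hom).
apply: (iff_trans sdE).
have [phiA phiM] := phi_hom; have theta1 := hom_to_auts1 theta_hom.
have phi1 : phi (gone (dot_law B)) =1 id.
  by move=> x; rewrite -gone_circ (hom_to_auts1 phi_hom).
have phi_1 b : phi b (gone (dot_law A)) = gone (dot_law A).
  by rewrite -gone_circ; apply: group_aut1.
split=> [brE | [[phiB _] gth phth] a x y b b'].
- split=> [|a b x|b b' x] /=.
  + split=> // b; case: (phiA b) => phi_bij phiC; split=> // x y.
    (* With b' = 1 the index b γ_b(1) b^-1 collapses to 1, so both θ's vanish. *)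
    have := brE (gone (dot_law A)) x y b (gone (dot_law B)).
    by rewrite gamma_1 gmulx1 gmulxV !theta1 !gamma1.
  + have := brE a (gone (dot_law A)) x (gone (dot_law B)) b.
    by rewrite !gmul1x gamma1 !phi1 gamma_1 gmul1x ginv1 gmulx1.
  + have := brE (gone (dot_law A)) (gone (dot_law A)) x b b'.
    by rewrite gmul1x phi_1 !gamma1 gmul1x.
(* Once φ_b and γ_a are distributed over the product, θ_b' moves left past φ_b, where its index
   becomes c, and then past γ_a. *)
- case: (phiB b) => _ phiD _; rewrite phiD gammaM; congr (_ · _).
  by have /= -> := phth b b' y; have /= -> := gth a _ (phi b y).
Qed.
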